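(* Let $\mathfrak{g}$ be a Lie algebra, $(M,\bullet)$ a $\mathfrak{g}$-module, $T: M \to \mathfrak{g}$ an $\mathcal{O}$-operator on $M$ over $\mathfrak{g}$, and $B : \mathfrak{g} \to M$ a $1$-cocycle in the Chevalley-Eilenberg complex of $\mathfrak{g}$ with coefficients in $M$ such that $\mathrm{id}_M + B\circ T : M\to M$ is invertible. Let $T_B := T\circ(\mathrm{id}_M + B\circ T)^{-1}: M\to\mathfrak{g}$ (which is again an $\mathcal{O}$-operator). Then the Lie algebras $(M,[~,~]^T)$ and $(M,[~,~]^{T_B})$ induced on $M$ by the $\mathcal{O}$-operators $T$ and $T_B$ are isomorphic.
   Context: All vector spaces are over a field of characteristic $0$. An $\mathcal{O}$-operator on a $\mathfrak{g}$-module $(M,\bullet)$ over the Lie algebra $\mathfrak{g}$ is a linear map $T: M\to\mathfrak{g}$ with $[T(m),T(n)] = T(T(m)\bullet n - T(n)\bullet m)$ for all $m,n\in M$. For an $\mathcal{O}$-operator $T$, $[m,n]^T := T(m)\bullet n - T(n)\bullet m$ is a Lie bracket on $M$. A linear map $B:\mathfrak{g}\to M$ is a $1$-cocycle if $B([x,y]) = x\bullet B(y) - y\bullet B(x)$ for all $x,y\in\mathfrak{g}$. The operator $T_B$ is called the gauge transformation of $T$ associated with $B$. *)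

(* Defs.v *)
From HB Require Import structures.
From mathcomp Require Import all_boot all_algebra.

Set Implicit Arguments.
Unset Strict Implicit.
Unset Printing Implicit Defensive.

Import GRing.Theory.
Local Open Scope ring_scope.

Record lieAlgType (F : fieldType) := LieAlg {
  lie_sort :> lmodType F;
  lie_bracket : {bilinear lie_sort -> lie_sort -> lie_sort};
  lie_bracketxx : forall x, lie_bracket x x = 0;
  lie_jacobi : forall x y z,
    lie_bracket x (lie_bracket y z) + lie_bracket y (lie_bracket z x)
      + lie_bracket z (lie_bracket x y) = 0
}.

Notation "[ 'lie' x , y ]" := (lie_bracket _ x y)
  (at level 0, x, y at level 99, format "[ 'lie'  x ,  y ]") : ring_scope.

Record lieModType (F : fieldType) (g : lieAlgType F) := LieMod {
  lie_mod_sort :> lmodType F;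
  lie_act : {bilinear g -> lie_mod_sort -> lie_mod_sort};
  lie_act_bracket : forall x y m,
    lie_act [lie x, y] m = lie_act x (lie_act y m) - lie_act y (lie_act x m)
}.

Notation "x \bullet m" := (lie_act _ x m)
  (at level 40, left associativity) : ring_scope.

Definition lie_isomorphic (F : fieldType) (g h : lieAlgType F) : Prop :=
  exists2 f : {linear g -> h},
    bijective f & forall x y, f [lie x, y] = [lie f x, f y].

Section OOperators.
Variables (F : fieldType) (g : lieAlgType F) (M : lieModType g).

Definition O_operator (T : {linear M -> g}) : Prop :=
  forall m n, [lie T m, T n] = T (T m \bullet n - T n \bullet m).

Definition cocycle1 (B : {linear g -> M}) : Prop :=
  forall x y, B [lie x, y] = x \bullet B y - y \bullet B x.

Definition O_bracket (T : {linear M -> g}) (m n : M) : M :=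
  T m \bullet n - T n \bullet m.

Lemma O_bracket_bilinear (T : {linear M -> g}) :
  bilinear_for *:%R *:%R (O_bracket T).
Proof.
split=> [n a m m' | m a n n']; rewrite /O_bracket /=.
  by rewrite [T (_ + _)]linearP linearDl linearZl_LR linearPr /= scalerBr opprD
    addrACA.
by rewrite [T (_ + _)]linearP linearDl linearZl_LR linearPr /= scalerBr opprD
  addrACA.
Qed.

HB.instance Definition _ (T : {linear M -> g}) :=
  bilinear_isBilinear.Build F M M M *:%R *:%R (O_bracket T)
    (O_bracket_bilinear T).

Lemma O_bracketxx (T : {linear M -> g}) m : O_bracket T m m = 0.
Proof. by rewrite /O_bracket subrr. Qed.

Lemma O_bracket_jacobi (T : {linear M -> g}) : O_operator T ->
  forall m n p, O_bracket T m (O_bracket T n p)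
    + O_bracket T n (O_bracket T p m) + O_bracket T p (O_bracket T m n) = 0.
Proof.
move=> hT.
have E m n p : O_bracket T m (O_bracket T n p) =
    T m \bullet (T n \bullet p) - T m \bullet (T p \bullet n)
    - (T n \bullet (T p \bullet m) - T p \bullet (T n \bullet m)).
  by rewrite {1}/O_bracket -[T (O_bracket T n p)]hT lie_act_bracket
    /O_bracket linearB.
move=> m n p; rewrite !E.
rewrite !opprB !addrA.
rewrite [LHS](ACl (1*12*(2*7)*(3*10)*(4*5)*(6*11)*(8*9)))/=.
by rewrite !subrr !addNr !addr0.
Qed.

Definition O_lie (T : {linear M -> g}) (hT : O_operator T) : lieAlgType F :=
  @LieAlg F M (O_bracket T) (O_bracketxx T) (O_bracket_jacobi hT).

End OOperators.

Section LinearInverse.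
Variables (F : fieldType) (U V : lmodType F) (f : {linear U -> V}).
Hypothesis bij_f : bijective f.

Fact linear_inv_subproof (v : V) : exists u, f u == v.
Proof. by case: bij_f => h _ fK; exists (h v); rewrite fK. Qed.

(* The inverse of f: since f is injective, the chosen preimage is unique. *)
Definition linear_inv (v : V) : U := xchoose (linear_inv_subproof v).

Lemma linear_invK : cancel linear_inv f.
Proof. by move=> v; apply/eqP/(xchooseP (linear_inv_subproof v)). Qed.

Lemma linear_invKV : cancel f linear_inv.
Proof. by move=> u; apply: (bij_inj bij_f); rewrite linear_invK. Qed.

Lemma linear_inv_is_linear : linear linear_inv.
Proof.
move=> a u v; apply: (bij_inj bij_f).
by rewrite linearP !linear_invK.
Qed.

HB.instance Definition _ :=
  GRing.isLinear.Build F V U *:%R linear_inv linear_inv_is_linear.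

End LinearInverse.

Definition gauge (F : fieldType) (g : lieAlgType F) (M : lieModType g)
    (T : {linear M -> g}) (B : {linear g -> M})
    (hTB : bijective (idfun \+ (B \o T))) : {linear M -> g} :=
  T \o linear_inv hTB.

(* Main.v *)
(* Put f = id + B \o T, so that T_B \o f = T. Since B is a cocycle,
   [f m, f n]^{T_B} = T m . f n - T n . f m = [m, n]^T + B [T m, T n]
   = [m, n]^T + B (T [m, n]^T) = f [m, n]^T, so f is the isomorphism.
   As f is onto, the same identity shows that T_B is an O-operator. *)
Require Import Defs.
From mathcomp Require Import all_boot all_algebra.

Import GRing.Theory.
Local Open Scope ring_scope.

Lemma gaugeK (F : fieldType) (g : lieAlgType F) (M : lieModType g)
    (T : {linear M -> g}) (B : {linear g -> M})
    (hTB : bijective (idfun \+ (B \o T))) (m : M) :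
  gauge hTB (m + B (T m)) = T m.
Proof. by congr (T _); apply: (linear_invKV hTB). Qed.

Lemma O_bracket_gauge (F : fieldType) (g : lieAlgType F) (M : lieModType g)
    (T : {linear M -> g}) (hT : O_operator T)
    (B : {linear g -> M}) (hB : cocycle1 B)
    (hTB : bijective (idfun \+ (B \o T))) (m n : M) :
  O_bracket (gauge hTB) (m + B (T m)) (n + B (T n)) =
    O_bracket T m n + B (T (O_bracket T m n)).
Proof.
(* Reading [hT] backwards exposes [B [lie T m, T n]], which the cocycle identity expands. *)
rewrite -[T (O_bracket T m n)]hT hB /O_bracket !gaugeK.
by rewrite !linearDr opprD addrACA.
Qed.

Lemma gauge_O_operator (F : fieldType) (g : lieAlgType F) (M : lieModType g)
    (T : {linear M -> g}) (hT : O_operator T)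
    (B : {linear g -> M}) (hB : cocycle1 B)
    (hTB : bijective (idfun \+ (B \o T))) :
  O_operator (gauge hTB).
Proof.
move=> m n; rewrite -/(O_bracket (gauge hTB) m n).
(* [gaugeK] evaluates [gauge hTB] only at points [q + B (T q)]; surjectivity gives every point this
   form. *)
have f_onto p : exists q, p = q + B (T q).
  by have [f' _ f'K] := hTB; exists (f' p); rewrite -[LHS]f'K.
have [m' ->] := f_onto m; have [n' ->] := f_onto n.
(* The bracket is again of the form [q + B (T q)], with [q = O_bracket T m' n'], so [gaugeK] applies
   on both sides and leaves [hT] at [m'], [n']. *)
by rewrite O_bracket_gauge // !gaugeK hT.
Qed.

Theorem proposition3p7 (F : fieldType) (charF0 : [pchar F] =i pred0)
    (g : lieAlgType F) (M : lieModType g)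
    (T : {linear M -> g}) (hT : O_operator T)
    (B : {linear g -> M}) (hB : cocycle1 B)
    (hTB : bijective (idfun \+ (B \o T))) :
  exists hG : O_operator (gauge hTB), lie_isomorphic (O_lie hT) (O_lie hG).
Proof.
exists (gauge_O_operator _ _ _ _ hT _ hB hTB).
exists (idfun \+ (B \o T) : {linear M -> M}) => // m n.
by apply: esym; apply: O_bracket_gauge.
Qed.
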